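(* Let $F$ be a (non-empty) totally bounded set in a metric space. Then for all $\theta \in (0,1)$ we have \[ \overline{\dim}_{\mathrm{B}}F \ \leq \ \dim_{\mathrm{A}}^\theta F \ \leq \ \min\left\{ \frac{\overline{\dim}_{\mathrm{B}}F}{1-\theta}, \ \dim_\mathrm{A} F \right\} . \]
   Context: For a subset $E$ of a metric space and $r>0$, $N(E,r)$ denotes the minimal number of balls of radius $r$ required to cover $E$, and $B(x,R)$ is the ball of radius $R$ centred at $x$. The Assouad dimension of $F$ is \[ \dim_{\mathrm A} F = \inf\Big\{\alpha : \exists C>0,\ \exists \rho>0,\ \forall\, 0<r<R\leq\rho,\ \forall x\in F,\ N(B(x,R)\cap F,r)\leq C (R/r)^{\alpha}\Big\}. \] For $\theta\in(0,1)$, the Assouad spectrum of $F$ at $\theta$ is \[ \dim_{\mathrm A}^{\theta} F = \inf\Big\{\alpha : \exists C>0,\ \exists \rho>0,\ \forall\, 0<R\leq\rho,\ \forall x\in F,\ N(B(x,R)\cap F,R^{1/\theta})\leq C \big(R/R^{1/\theta}\big)^{\alpha}\Big\}. \] The upper box dimension of a totally bounded set $F$ is $\overline{\dim}_{\mathrm B}F=\limsup_{R\to0}\frac{\log N(F,R)}{-\log R}$. *)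

(* Defs.v *)
From mathcomp Require Import all_boot all_order all_algebra.
From mathcomp Require Import all_classical all_reals all_analysis.

Set Implicit Arguments.
Unset Strict Implicit.
Unset Printing Implicit Defensive.

Import Order.TTheory GRing.Theory Num.Theory.
Import numFieldNormedType.Exports.

Local Open Scope classical_set_scope.
Local Open Scope ring_scope.

(* [ball x r] is the open ball; centres range over the ambient space [X] and
   need not lie in [E]. *)
Definition covered_by_balls (R : realType) (X : metricType R)
    (E : set X) (r : R) (n : nat) : Prop :=
  exists c : 'I_n -> X, E `<=` \bigcup_i ball (c i) r.

(* N(E, r), equal to +oo when no finite family of [r]-balls covers [E]. *)
Definition covering_number (R : realType) (X : metricType R)
    (E : set X) (r : R) : \bar R :=
  ereal_inf [set (n%:R)%:E | n in covered_by_balls E r].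

Definition totally_bounded (R : realType) (X : metricType R)
    (E : set X) : Prop :=
  forall r : R, 0 < r -> exists n : nat, covered_by_balls E r n.

(* The dimensions are extended reals; the infimum of the empty set is +oo. *)
Definition assouad_dim (R : realType) (X : metricType R) (F : set X) : \bar R :=
  ereal_inf [set alpha%:E | alpha in [set alpha : R |
    exists2 C : R, 0 < C & exists2 rho0 : R, 0 < rho0 &
      forall r rho : R, 0 < r -> r < rho -> rho <= rho0 ->
      forall x : X, F x ->
        (covering_number (ball x rho `&` F) r
           <= (C * (rho / r) `^ alpha)%:E)%E]].

Definition assouad_spectrum (R : realType) (X : metricType R)
    (theta : R) (F : set X) : \bar R :=
  ereal_inf [set alpha%:E | alpha in [set alpha : R |
    exists2 C : R, 0 < C & exists2 rho0 : R, 0 < rho0 &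
      forall rho : R, 0 < rho -> rho <= rho0 ->
      forall x : X, F x ->
        (covering_number (ball x rho `&` F) (rho `^ theta^-1)
           <= (C * (rho / rho `^ theta^-1) `^ alpha)%:E)%E]].

Definition upper_box_dim (R : realType) (X : metricType R) (F : set X) : \bar R :=
  limf_esup (fun r : R => lne (covering_number F r) / (- ln r)%:E)%E 0^'+.

(* Main.v *)
Require Import Defs.
From mathcomp Require Import all_boot all_order all_algebra.
From mathcomp Require Import all_classical all_reals all_analysis.
From mathcomp Require Import ring lra.

Import Order.TTheory GRing.Theory Num.Theory.
Import numFieldNormedType.Exports.

Local Open Scope classical_set_scope.
Local Open Scope ring_scope.

(** Write N(E, r) for the covering number.  The upper bounds on the spectrum
    compare admissible exponents.  Since rho^(1/theta) < rho for small rho, an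
    exponent admissible for the Assouad dimension is admissible for the
    spectrum.  If z (1 - theta) exceeds the upper box dimension, then, with
    r = rho^(1/theta), already N(F, r) <= r^(-z (1 - theta)) = (rho / r)^z, so z
    is admissible as well.

    For the lower bound, let alpha be admissible for the spectrum with
    constant C.  Cover F by balls of radius r^theta / 2 and cover the trace of
    F on each of them by balls of radius r; this gives
    N(F, r) <= N(F, r^theta / 2) C (r^theta / r)^alpha
    ([covering_number_mul]).  Passing to the upper limit here would give
    b <= theta b + (1 - theta) alpha for the upper box dimension b, which
    says nothing when b is infinite.  Instead, for any s > alpha, the
    inequality propagates, for small r, a bound N(F, r) <= A r^(-s) from the
    scale r^theta / 2 to the finer scale r with the same constant A, because the
    surplus factor r^((1 - theta)(s - alpha)) absorbs both C and the constant
    2^s due to the halved radius.  As F is totally bounded, such a bound holds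
    for some A down to a fixed scale, and hence at all scales by induction
    ([powR_bound_of_step]); so b <= s for every s > alpha. *)

(** * Extended reals and real powers *)

Lemma lee_from_above (R : realType) (x y : \bar R) :
  (forall z : R, (y < z%:E)%E -> (x <= z%:E)%E) -> (x <= y)%E.
Proof.
case: y => [y||] H; last 2 first.
- exact: leey.
- rewrite leeNy_eq; case: x H => // [x|] H.
    have := H (x - 1) (ltNyr _); rewrite lee_fin; lra.
  by have := H 0 (ltNyr _).
apply/lee_addgt0Pr => e e0; rewrite -EFinD; apply: H; rewrite lte_fin; lra.
Qed.

Lemma near_at_right0P (R : realType) (P : R -> Prop) :
  (\forall r \near 0^'+, P r) <->
  exists2 d : R, 0 < d & forall r, 0 < r -> r <= d -> P r.
Proof.
split=> [[d /= d0 dP]|[d d0 dP]].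
  exists (d / 2) => [|r r0 rd]; first by rewrite divr_gt0.
  by apply: dP => //=; rewrite sub0r normrN gtr0_norm//; lra.
near=> r; apply: dP; near: r; [exact: nbhs_right_gt|exact: nbhs_right_le].
Unshelve. all: by end_near. Qed.

Lemma near_powR_le (R : realType) (a e : R) :
  0 < a -> 0 < e -> \forall r \near (0:R)^'+, r `^ a <= e.
Proof.
move=> a0 e0; near=> r; apply/ltW; near: r.
exact: (cvgr_lt _ (powR_cvg0 a0) _ e0).
Unshelve. all: by end_near. Qed.

Lemma powR_scale_ratio (R : realType) (theta a r : R) :
  0 < r -> (r `^ theta / r) `^ a = r `^ ((theta - 1) * a).
Proof.
move=> r0; rewrite powRrM powRB ?powRr1 ?(ltW r0)//.
by apply/implyP => _; rewrite gt_eqF.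
Qed.

Lemma powR_invK (R : realType) (theta r : R) : 0 < theta -> 0 <= r ->
  (r `^ theta) `^ theta^-1 = r.
Proof. by move=> t0 r0; rewrite -powRrM mulfV ?gt_eqF// powRr1. Qed.

(** * Covering numbers *)

(** The infimum, taken over natural numbers, is attained: a real upper bound on
    the covering number is witnessed by an actual cover. *)
Lemma covering_number_leP (R : realType) (X : metricType R) (E : set X)
    (r y : R) :
  (covering_number E r <= y%:E)%E <->
  exists2 n, covered_by_balls E r n & n%:R <= y.
Proof.
split=> [le_y|[n En ny]]; last first.
  by apply: ge_ereal_inf; exists n%:R%:E; [exists n|rewrite lee_fin].
(* An integer below floor y + 1 is at most y, so an element of the set that is
   less than floor y + 1 is good enough. *)
have /ereal_inf_lt[_ [n En <-]] :
    (covering_number E r < (Num.floor y + 1)%:~R%:E)%E.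
  by apply: le_lt_trans le_y _; rewrite lte_fin floorD1_gt.
rewrite lte_fin -[n%:R]/((Posz n)%:~R) ltr_int ltzD1 => ny; exists n => //.
by apply: le_trans (floor_le y); rewrite -[n%:R]/((Posz n)%:~R) ler_int.
Qed.

Lemma covering_number_ge0 (R : realType) (X : metricType R) (E : set X)
    (r : R) : (0 <= covering_number E r)%E.
Proof. by apply: le_ereal_inf_tmp => _ [n _ <-]; rewrite lee_fin. Qed.

Lemma covering_number_subset (R : realType) (X : metricType R) (E E' : set X)
    (r : R) : E `<=` E' -> (covering_number E r <= covering_number E' r)%E.
Proof.
move=> EE'; apply: ereal_inf_le_tmp => _ [n [c E'c] <-].
by exists n => //; exists c; apply: subset_trans E'c.
Qed.

Lemma covering_number_nonincreasing (R : realType) (X : metricType R)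
    (E : set X) (r r' : R) :
  r <= r' -> (covering_number E r' <= covering_number E r)%E.
Proof.
move=> rr'; apply: ereal_inf_le_tmp => _ [n [c Ec] <-]; exists n => //; exists c.
by apply: subset_trans Ec _ => x [i _ cx]; exists i => //; exact: le_ball cx.
Qed.

Lemma covered_by_balls_finType (R : realType) (X : metricType R) (E : set X)
    (r : R) (T : finType) (c : T -> X) :
  E `<=` \bigcup_t ball (c t) r -> covered_by_balls E r #|T|.
Proof.
move=> Ec; exists (c \o enum_val) => x /Ec[t _ tx].
by exists (enum_rank t); rewrite //= enum_rankK.
Qed.

(** Covers at two scales compose.  The given cover of F by r'-balls has centres
    anywhere in the space; a centre whose ball meets F is traded for a point of
    F, which is why the local bound concerns balls of twice the radius. *)
Lemma covering_number_mul (R : realType) (X : metricType R) (F : set X)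
    (r r' M K : R) : 0 <= K ->
  (covering_number F r' <= M%:E)%E ->
  (forall x, F x -> (covering_number (ball x (r' + r') `&` F) r <= K%:E)%E) ->
  (covering_number F r <= (M * K)%:E)%E.
Proof.
move=> K0 /covering_number_leP[m [c Fc] mM] FK.
(* A ball that misses F contributes the empty family of smaller balls. *)
have subcover i : exists nd : {n : nat & 'I_n -> X},
    (tag nd)%:R <= K /\ ball (c i) r' `&` F `<=` \bigcup_j ball (tagged nd j) r.
  have [[x [cx Fx]]|noF] := pselect (ball (c i) r' `&` F !=set0); last first.
    exists (existT _ 0%N (fun _ => c i)); split=> // x cFx.
    by case: noF; exists x.
  have /covering_number_leP[n [d xd] nK] := FK _ Fx.
  exists (existT _ n d); split=> //= y [cy Fy]; apply: xd; split=> //.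
  exact: ball_triangle (ball_sym cx) cy.
have [nd ndP] := choice subcover.
apply/covering_number_leP.
exists #|{: {i : 'I_m & 'I_(tag (nd i))}}|.
  apply: (@covered_by_balls_finType _ _ _ _ _
            (fun t => tagged (nd (tag t)) (tagged t))) => x Fx.
  have [i _ cx] := Fc _ Fx; have [_ /(_ x (conj cx Fx))[j _ jx]] := ndP i.
  by exists (existT _ i j).
rewrite card_tagged sumnE big_map big_enum natr_sum /=.
apply: (@le_trans _ _ (m%:R * K)); last exact: ler_wpM2r.
rewrite -[m in leRHS]card_ord mulr_natl -sumr_const.
by apply: ler_sum => i _; rewrite card_ord; have [] := ndP i.
Qed.

(** * Upper box dimension as a power bound on covering numbers *)

Lemma le_lne_div_ln (R : realType) (r s : R) (y : \bar R) :
  0 < r < 1 -> (0 <= y)%E ->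
  (lne y / (- ln r)%:E <= s%:E)%E = (y <= (r `^ (- s))%:E)%E.
Proof.
move=> /andP[r0 r1] y0.
have ln0 : 0 < - ln r by rewrite oppr_gt0 ln_lt0// r0.
rewrite inver gt_eqF// lee_pdivrMr// -EFinM mulrN -mulNr -ln_powR.
rewrite -lne_EFin ?powR_gt0// lee_lne// in_itv/= ?y0 ?leey//.
by rewrite lee_fin powR_ge0.
Qed.

Lemma upper_box_dim_le (R : realType) (X : metricType R) (F : set X) (s : R) :
  (\forall r \near 0^'+, (covering_number F r <= (r `^ (- s))%:E)%E) ->
  (upper_box_dim F <= s%:E)%E.
Proof.
move=> Fs; apply: ge_ereal_inf.
pose V := [set r : R | 0 < r < 1 /\ (covering_number F r <= (r `^ (- s))%:E)%E].
exists (ereal_sup [set lne (covering_number F r) / (- ln r)%:E | r in V])%E;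
    last first.
  apply/ereal_supP.
  by move=> _ [r [r01 rs] <-]; rewrite le_lne_div_ln// covering_number_ge0.
exists V => //; rewrite /V; near=> r; split; last by near: r.
by apply/andP; split; near: r; [exact: nbhs_right_gt|exact: nbhs_right_lt].
Unshelve. all: by end_near. Qed.

Lemma upper_box_dim_lt (R : realType) (X : metricType R) (F : set X) (s : R) :
  (upper_box_dim F < s%:E)%E ->
  \forall r \near 0^'+, (covering_number F r <= (r `^ (- s))%:E)%E.
Proof.
move=> /ereal_inf_lt[_ [V V0 <-] /ltW Vs]; near=> r.
rewrite -le_lne_div_ln ?covering_number_ge0//; last first.
  by apply/andP; split; near: r; [exact: nbhs_right_gt|exact: nbhs_right_lt].
apply: le_trans Vs; apply: ereal_sup_ubound; exists r => //.
by near: r; exact: V0.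
Unshelve. all: by end_near. Qed.

(** * From one scale to a finer one *)

(** A bound by A r^(-s) that is inherited from the scale g r >= 2 r holds at
    every scale up to 1: it is proved for r >= r1 / 2^n by induction on n.  The
    factor r1^(-|s|) in A makes the base case r >= r1 hold for either sign of
    s. *)
Lemma powR_bound_of_step (R : realType) (f : R -> \bar R) (g : R -> R)
    (s r1 : R) : 0 < r1 <= 1 ->
  {homo f : r r' / r <= r' >-> (r' <= r)%E} -> f r1 \is a fin_num ->
  (0 <= f r1)%E ->
  (forall r, 0 < r -> r <= r1 -> 2 * r <= g r <= 1) ->
  (forall r A, 0 < r -> r <= r1 -> 0 <= A ->
    (f (g r) <= (A * g r `^ (- s))%:E)%E -> (f r <= (A * r `^ (- s))%:E)%E) ->
  exists2 A, 0 <= A &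
    forall r, 0 < r -> r <= 1 -> (f r <= (A * r `^ (- s))%:E)%E.
Proof.
move=> /andP[r1_gt0 r1_le1] f_noninc f1_fin f1_ge0 gP stepP.
pose A := fine (f r1) * r1 `^ (- `|s|).
have A0 : 0 <= A by rewrite mulr_ge0 ?fine_ge0 ?powR_ge0.
exists A => //.
have base r : r1 <= r -> r <= 1 -> (f r <= (A * r `^ (- s))%:E)%E.
  move=> r1r r_le1; apply: le_trans (f_noninc _ _ r1r) _.
  rewrite -(fineK f1_fin) lee_fin /A -mulrA ler_peMr ?fine_ge0//.
  have r0 : 0 < r by exact: lt_le_trans r1r.
  rewrite [r1 `^ _]powRN ler_pdivlMl ?powR_gt0// mulr1.
  apply: (@le_trans _ _ (r `^ `|s|)).
    by rewrite ge0_ler_powR ?nnegrE// ltW.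
  by rewrite ger_powR ?r0// -normrN ler_norm.
have scale n r : r1 <= r * 2 ^+ n -> 0 < r -> r <= 1 ->
    (f r <= (A * r `^ (- s))%:E)%E.
  elim: n r => [|n IHn] r; first by rewrite mulr1 => *; exact: base.
  move=> r1r r0 r_le1; have [r1r'|rr1] := leP r1 r; first exact: base.
  have /andP[rg g1] := gP _ r0 (ltW rr1).
  apply: stepP => //; first exact: ltW.
  apply: IHn => //; last by apply: lt_le_trans rg; rewrite mulr_gt0.
  by apply: le_trans r1r _; rewrite exprS mulrA [r * 2]mulrC ler_wpM2r//
    exprn_ge0.
move=> r r0; apply: (scale (Num.bound (r1 / r))) => //.
rewrite -ler_pdivrMl// mulrC; apply/ltW.
apply: (lt_trans (archi_boundP _)); first by rewrite divr_ge0// ltW.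
by rewrite -natrX ltr_nat ltn_expl.
Qed.

(** * The three inequalities *)

(** The lower bound for one admissible exponent alpha: the power bound with
    exponent s is obtained by descending through scales, and the multiplicative
    constant it carries is removed by raising s to z. *)
Lemma upper_box_dim_le_exponent (R : realType) (X : metricType R) (F : set X)
    (theta alpha C rho0 : R) :
  totally_bounded F -> 0 < theta -> theta < 1 -> 0 < C -> 0 < rho0 ->
  (forall rho, 0 < rho -> rho <= rho0 -> forall x, F x ->
    (covering_number (ball x rho `&` F) (rho `^ theta^-1)
       <= (C * (rho / rho `^ theta^-1) `^ alpha)%:E)%E) ->
  (upper_box_dim F <= alpha%:E)%E.
Proof.
move=> F_tb theta0 theta1 C0 rho00 Falpha.
apply: lee_from_above => z; rewrite lte_fin => alphaz.
pose s := (alpha + z) / 2.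
have alphas : alpha < s by rewrite /s; lra.
have sz : s < z by rewrite /s; lra.
pose B : R := 2^-1 `^ (- s).
have B0 : 0 < B by rewrite powR_gt0.
have theta1' : 0 < 1 - theta by lra.
(* Below r1, r^theta is an admissible radius, r^theta / 2 >= 2 r, and one step
   down in scale costs a factor at most 1; B comes from the 2 in r^theta / 2. *)
have [r1 r1_gt0 r1P] : exists2 d : R, 0 < d & forall r, 0 < r -> r <= d ->
    [/\ r <= 1, r `^ theta <= 1, r `^ theta <= rho0, r `^ (1 - theta) <= 4^-1
      & r `^ ((1 - theta) * (s - alpha)) <= (B * C)^-1].
  apply/near_at_right0P; near=> r; split; near: r.
  - exact: nbhs_right_le.
  - exact: near_powR_le.
  - exact: near_powR_le.
  - by apply: near_powR_le => //; rewrite invr_gt0.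
  - apply: near_powR_le; first by rewrite mulr_gt0// subr_gt0.
    by rewrite invr_gt0 mulr_gt0.
have r1_le1 : r1 <= 1 by have [] := r1P _ r1_gt0 (lexx _).
have F1_fin : covering_number F r1 \is a fin_num.
  have [n Fn] := F_tb _ r1_gt0.
  have Fle : (covering_number F r1 <= n%:R%:E)%E.
    by apply/covering_number_leP; exists n.
  by rewrite ge0_fin_numE ?covering_number_ge0// (le_lt_trans Fle)// ltry.
have [A A0 AP] : exists2 A, 0 <= A & forall r, 0 < r -> r <= 1 ->
    (covering_number F r <= (A * r `^ (- s))%:E)%E.
  apply: (@powR_bound_of_step _ _ (fun r => r `^ theta / 2) s r1).
  - by rewrite r1_gt0.
  - by move=> r r' ; exact: covering_number_nonincreasing.
  - exact: F1_fin.
  - exact: covering_number_ge0.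
  - move=> r r0 /(r1P _ r0)[_ rt1 _ rt4 _]; apply/andP; split; last lra.
    (* r <= r^theta / 4, as r = r^theta * r^(1 - theta). *)
    have rE : r = r `^ theta * r `^ (1 - theta).
      rewrite -powRD; last by apply/implyP => _; rewrite gt_eqF.
      by rewrite addrC subrK powRr1// ltW.
    have := powR_ge0 r theta; nra.
  - move=> r A r0 /(r1P _ r0)[_ _ rt_rho _ r_small] A0 FA.
    have rt0 : 0 < r `^ theta by rewrite powR_gt0.
    have := covering_number_mul _ _ _ r _ _ (C * (r `^ theta / r) `^ alpha) _ FA _.
    rewrite -splitr => /(_ _ _)/le_trans; apply.
    + by rewrite mulr_ge0 ?powR_ge0 ?ltW.
    + by move=> x /(Falpha _ rt0 rt_rho); rewrite powR_invK// ltW.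
    rewrite lee_fin powR_scale_ratio// powRM ?invr_ge0 ?powR_ge0// -/B.
    rewrite -powRrM.
    have rD a b : r `^ (a + b) = r `^ a * r `^ b.
      by rewrite powRD//; apply/implyP => _; rewrite gt_eqF.
    have -> : A * (r `^ (theta * - s) * B) * (C * r `^ ((theta - 1) * alpha)) =
        A * r `^ (- s) * (B * C * r `^ ((1 - theta) * (s - alpha))).
      transitivity (A * (B * C) * r `^ (theta * - s + (theta - 1) * alpha)).
        by rewrite rD; ring.
      have -> : theta * - s + (theta - 1) * alpha =
          - s + (1 - theta) * (s - alpha) by ring.
      by rewrite rD; ring.
    rewrite ler_piMr ?mulr_ge0 ?powR_ge0//.
    by rewrite -ler_pdivlMl ?mulr1 ?mulr_gt0.
apply: upper_box_dim_le; near=> r.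
have r0 : 0 < r by near: r; exact: nbhs_right_gt.
apply: (le_trans (AP _ r0 _)); first by near: r; exact: nbhs_right_le.
have -> : - s = - z + (z - s) by ring.
rewrite powRD; last by apply/implyP => _; rewrite gt_eqF.
rewrite lee_fin mulrCA ler_piMr ?powR_ge0//.
have rA : r `^ (z - s) <= (A + 1)^-1.
  near: r; apply: near_powR_le; first by rewrite subr_gt0.
  by rewrite invr_gt0; lra.
apply: (le_trans (ler_wpM2l A0 rA)).
by rewrite ler_pdivrMr; lra.
Unshelve. all: by end_near. Qed.

Lemma assouad_spectrum_le_assouad_dim (R : realType) (X : metricType R)
    (F : set X) (theta : R) : 0 < theta -> theta < 1 ->
  (assouad_spectrum theta F <= assouad_dim F)%E.
Proof.
move=> theta0 theta1.
apply: ereal_inf_le_tmp => _ [alpha [C C0 [rho0 rho00 FC]] <-].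
exists alpha => //; exists C => //; exists (Num.min rho0 2^-1).
  by rewrite lt_min rho00 invr_gt0 /=.
move=> rho rho_gt0; rewrite le_min => /andP[rho_le rho_half] x Fx.
apply: FC rho_le _ Fx; first exact: powR_gt0.
rewrite -mulr_powRB1 ?invr_gt0 ?ltW// gtr_pMr//.
have e0 : 0 < theta^-1 - 1 by rewrite subr_gt0 invf_gt1.
have : rho `^ (theta^-1 - 1) < 1 `^ (theta^-1 - 1).
  by rewrite gt0_ltr_powR ?nnegrE ?(ltW rho_gt0)//; lra.
by rewrite powR1.
Qed.

Lemma assouad_spectrum_le_upper_box_dim (R : realType) (X : metricType R)
    (F : set X) (theta : R) : 0 < theta -> theta < 1 ->
  (assouad_spectrum theta F <= upper_box_dim F / (1 - theta)%:E)%E.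
Proof.
move=> theta0 theta1.
have theta1' : 0 < 1 - theta by lra.
apply: lee_from_above => z; rewrite inver gt_eqF// lte_pdivrMr// -EFinM.
move=> /upper_box_dim_lt/near_at_right0P[d d0 Fd].
apply: ereal_inf_lbound; exists z => //; exists 1 => //.
exists (d `^ theta); first exact: powR_gt0.
move=> rho rho0 rho_d x Fx; set r := rho `^ theta^-1.
have r0 : 0 < r by exact: powR_gt0.
have rhoE : rho = r `^ theta.
  by rewrite /r powRAC powR_invK// ltW.
rewrite mul1r {2}rhoE powR_scale_ratio//.
apply: (le_trans (covering_number_subset _ _ _ _ _ (@subIsetr _ _ _))).
rewrite [_ * z]mulrC -opprB mulrN; apply: Fd => //.
rewrite -(powR_invK _ _ _ theta0 (ltW d0)) /r.
by rewrite ge0_ler_powR ?nnegrE ?invr_ge0 ?powR_ge0 ?(ltW theta0) ?(ltW rho0).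
Qed.

Theorem proposition3p1 (R : realType) (X : metricType R) (F : set X)
    (F_neq0 : F !=set0) (F_tb : totally_bounded F)
    (theta : R) (theta_gt0 : 0 < theta) (theta_lt1 : theta < 1) :
  (upper_box_dim F <= assouad_spectrum theta F)%E /\
  (assouad_spectrum theta F
     <= Order.min (upper_box_dim F / (1 - theta)%:E) (assouad_dim F))%E.
Proof.
split.
  apply: le_ereal_inf_tmp => _ [alpha [C C0 [rho0 rho00 FC]] <-].
  exact: (upper_box_dim_le_exponent _ _ _ _ _ _ _ F_tb theta_gt0 theta_lt1 C0 rho00 FC).
rewrite le_min; apply/andP; split.
  exact: assouad_spectrum_le_upper_box_dim.
exact: assouad_spectrum_le_assouad_dim.
Qed.
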